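(* Let $A$ and $B$ be two subspaces of $\mathbb{Z}_{p^s}^n$. Then $$\dim(A\vee B)=\dim(A)+\dim(B)-\dim(A\cap B)=\rho\begin{pmatrix}A\\ B\end{pmatrix}.$$
   Context: $p$ is a prime, $s\ge1$, $R=\mathbb{Z}_{p^s}$; vectors are row vectors. A set $\{\alpha_1,\dots,\alpha_k\}\subseteq R^n$ is unimodular if the matrix with rows $\alpha_i$ has a right inverse over $R$. For a submodule (linear subset) $V\subseteq R^n$, $\dim(V)$ is the largest size of a unimodular subset of $V$. A $k$-subspace ($k\ge1$) is a submodule having a unimodular basis of $k$ vectors; the $0$-subspace is $\{0\}$. A subspace is identified with a matrix representation (a matrix whose rows form such a basis), and $\begin{pmatrix}A\\ B\end{pmatrix}$ is the matrix obtained by stacking representations of $A$ and $B$. The inner rank $\rho(M)$ of a nonzero matrix $M\in R^{a\times b}$ is the least $r$ such that $M=CD$ with $C\in R^{a\times r}$, $D\in R^{r\times b}$; $\rho(0)=0$. $A\cap B$ is the set-theoretic intersection (a linear subset, not necessarily a subspace). $A\vee B$ denotes the set of all subspaces of minimal dimension containing both $A$ and $B$ (joins), and $\dim(A\vee B)$ is that minimal dimension. *)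

(* Defs.v *)
From HB Require Import structures.
From mathcomp Require Import all_boot all_order all_algebra.
Set Implicit Arguments.
Unset Strict Implicit.
Unset Printing Implicit Defensive.
Import GRing.Theory.
Local Open Scope ring_scope.

Section Defs.
Variables (R : finComNzRingType) (n : nat).
Implicit Types (V W A B S : {set 'rV[R]_n}).

Definition right_invertible k (M : 'M[R]_(k, n)) : bool :=
  [exists N : 'M[R]_(n, k), M *m N == 1%:M].

(* The rows are listed in the order of [enum S]; the order is immaterial. *)
Definition rows_mx S : 'M[R]_(#|S|, n) := \matrix_(i < #|S|) enum_val i.

Definition unimodular S : bool := right_invertible (rows_mx S).

(* [S = set0] is unimodular, so the maximum is over a nonempty family. *)
Definition unimod_dim V : nat :=
  \max_(S : {set 'rV[R]_n} | (S \subset V) && unimodular S) #|S|.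

Definition rows_basis k (M : 'M[R]_(k, n)) V : bool :=
  [forall x : 'rV[R]_k, (x *m M == 0) ==> (x == 0)]
  && (V == [set x *m M | x : 'rV[R]_k]).

Definition mx_represents k (M : 'M[R]_(k, n)) V : bool :=
  right_invertible M && rows_basis M V.

(* The k-subspaces are those with [#|S| = k]; the empty basis gives exactly
   the 0-subspace. *)
Definition subspace V : bool :=
  [exists S : {set 'rV[R]_n}, mx_represents (rows_mx S) V].

Lemma subspaceT : subspace [set: 'rV[R]_n].
Proof.
pose S := [set (delta_mx 0 i : 'rV[R]_n) | i : 'I_n].
have f_ex (i : 'I_#|S|) : exists j : 'I_n, enum_val i == delta_mx 0 j.
  by have /imsetP[j _ ->] := enum_valP i; exists j.
pose f i := xchoose (f_ex i).
have fE i : enum_val i = delta_mx 0 (f i) by apply/eqP/(xchooseP (f_ex i)).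
have f_inj : injective f by move=> i j fij; apply: enum_val_inj; rewrite !fE fij.
have delta_inj : injective (fun i : 'I_n => delta_mx 0 i : 'rV[R]_n).
  move=> i j /rowP/(_ j); rewrite !mxE !eqxx /=.
  by case: (eqVneq j i) => //= _ /esym/eqP; rewrite oner_eq0.
have f_surj j : exists i, f i = j.
  have Sj : (delta_mx 0 j : 'rV[R]_n) \in S by apply: imset_f.
  exists (enum_rank_in Sj (delta_mx 0 j)).
  by apply: delta_inj; rewrite -fE enum_rankK_in.
have inv : rows_mx S *m (rows_mx S)^T = 1%:M.
  apply/matrixP=> i j; rewrite !mxE (bigD1 (f i)) //= big1 => [|k kfi].
    by rewrite !mxE !fE !mxE !eqxx mul1r addr0 /= (inj_eq f_inj).
  by rewrite !mxE !fE !mxE (negPf kfi) andbF mul0r.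
apply/existsP; exists S.
apply/and3P; split.
- by apply/existsP; exists (rows_mx S)^T; apply/eqP.
- apply/forallP=> x; apply/implyP=> /eqP x0.
  by rewrite -[x]mulmx1 -inv mulmxA x0 mul0mx.
apply/eqP/esym/setP=> v; rewrite inE; apply/imsetP.
exists (v *m (rows_mx S)^T) => //.
suff -> : v = \sum_i v 0 (f i) *: (row i (rows_mx S)).
  rewrite -mulmxA; set T := _^T *m _.
  rewrite mulmx_suml; apply: eq_bigr => i _.
  rewrite -scalemxAl /T mulmxA rowE -(mulmxA _ _ _^T) inv mulmx1.
  by [].
rewrite [LHS]row_sum_delta.
apply/rowP=> j; rewrite !summxE.
have [i0 <-] := f_surj j.
rewrite (bigD1 (f i0)) //= big1 => [|k kf]; last first.
  by rewrite !mxE eqxx eq_sym (negPf kf) mulr0.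
rewrite [RHS](bigD1 i0) //= big1 => [|k kf]; last first.
  by rewrite !mxE fE !mxE eqxx (inj_eq f_inj) eq_sym (negPf kf) mulr0.
by rewrite !mxE fE !mxE.
Qed.

Definition upper_subspace A B W : bool :=
  [&& subspace W, A \subset W & B \subset W].

Definition joins A B : {set {set 'rV[R]_n}} :=
  [set W | upper_subspace A B W
         & [forall W' : {set 'rV[R]_n},
              upper_subspace A B W' ==> (unimod_dim W <= unimod_dim W')%N]].

Lemma upper_subspace_dim A B :
  exists d, [exists W : {set 'rV[R]_n}, upper_subspace A B W && (unimod_dim W == d)].
Proof.
exists (unimod_dim [set: 'rV[R]_n]); apply/existsP; exists [set: 'rV[R]_n].
by rewrite /upper_subspace subspaceT !subsetT eqxx.
Qed.

Definition dim_join A B : nat := ex_minn (upper_subspace_dim A B).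

Lemma dim_joinsE A B W : W \in joins A B -> unimod_dim W = dim_join A B.
Proof.
rewrite inE => /andP[uW /forallP minW]; rewrite /dim_join.
case: ex_minnP => d /existsP[W' /andP[uW' /eqP dW']] mind.
apply/eqP; rewrite eqn_leq -{1}dW' (implyP (minW W')) //=.
by apply: mind; apply/existsP; exists W; rewrite uW eqxx.
Qed.

Lemma joins_neq0 A B : joins A B != set0.
Proof.
have /existsP[W /andP[uW /eqP dW]] :
    [exists W : {set 'rV[R]_n}, upper_subspace A B W && (unimod_dim W == dim_join A B)].
  by rewrite /dim_join; case: ex_minnP.
apply/set0Pn; exists W; rewrite inE uW /=; apply/forallP=> W'; apply/implyP=> uW'.
rewrite dW /dim_join; case: ex_minnP => d _; apply.
by apply/existsP; exists W'; rewrite uW' eqxx.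
Qed.

End Defs.

Section InnerRank.
Variables (R : finComNzRingType) (a b : nat).
Implicit Types M : 'M[R]_(a, b).

Definition factors_through M (r : nat) : bool :=
  [exists C : 'M[R]_(a, r), exists D : 'M[R]_(r, b), M == C *m D].

Lemma factors_through_ex M : exists r, factors_through M r.
Proof.
by exists a; apply/existsP; exists 1%:M; apply/existsP; exists M; rewrite mul1mx.
Qed.

Definition inner_rank M : nat :=
  if M == 0 then 0%N else ex_minn (factors_through_ex M).

End InnerRank.

(* Main.v *)
(* Over 'Z_q every matrix has a Smith normal form, inherited from the integers.
   For q = p ^ s the ring has an element c != 0 (namely p ^ (s - 1)) that is a
   multiple of every nonzero element.  Scaling the r nonzero elementary
   divisors of M up to c shows that M does not factor through fewer than r
   dimensions, and that a unimodular family of linear relations between the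
   m rows of M has at most m - r members; both bounds are attained.  For the
   stacked matrix M of A and B, a factorization M = C D with D unimodular of
   r rows gives a join of dimension r, while the unimodular families of
   relations correspond to those of A :&: B. *)
Require Import Defs.
From mathcomp Require Import all_boot all_order all_algebra.
Set Implicit Arguments.
Unset Strict Implicit.
Unset Printing Implicit Defensive.
Import GRing.Theory.
Local Open Scope ring_scope.

(** * Smith normal form over ['Z_q] *)

Lemma sorted_dvdz_nth (d : seq int) i j :
  sorted dvdz d -> (i <= j)%N -> (d`_i %| d`_j)%Z.
Proof.
move=> d_sorted le_ij; have [lt_jd | le_dj] := ltnP j (size d); last first.
  by rewrite (nth_default _ le_dj) dvdz0.
apply: (sorted_leq_nth _ _ _ d_sorted) => //; first exact: dvdz_trans.
- exact: dvdzz.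
- by rewrite inE (leq_ltn_trans le_ij).
Qed.

(** Lift the entries to the integers, take the Smith form there and reduce modulo [q]; invertible
    integer matrices stay invertible. Of the divisibility chain only its consequence for zeros is
    kept, which makes the nonzero divisors an initial segment. *)
Lemma Zp_smith q m n (M : 'M['Z_q]_(m, n)) :
  exists (L : 'M['Z_q]_m) (U : 'M['Z_q]_n) (e : nat -> 'Z_q),
    [/\ L \in unitmx, U \in unitmx,
        forall i j, (i <= j)%N -> e i = 0 -> e j = 0
      & M = L *m (\matrix_(i, j) (e i *+ (i == j :> nat))) *m U].
Proof.
pose f : {rmorphism int -> 'Z_q} := intr.
pose M0 : 'M[int]_(m, n) := \matrix_(i, j) (M i j : nat)%:Z.
have -> : M = map_mx f M0.
  by apply/matrixP=> i j; rewrite !mxE /f /= -pmulrn natr_Zp.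
have [L uL [U uU [d d_sorted ->]]] := int_Smith_normal_form M0.
have unitf k (N : 'M[int]_k) : N \in unitmx -> map_mx f N \in unitmx.
  by rewrite !unitmxE det_map_mx; apply: rmorph_unit.
exists (map_mx f L), (map_mx f U), (fun i => f d`_i).
split=> [|||]; [exact: unitf | exact: unitf | | ].
  move=> i j /(sorted_dvdz_nth d_sorted)/dvdzP[c ->] ei0.
  by rewrite rmorphM /= ei0 mulr0.
rewrite !map_mxM; congr (_ *m _ *m _).
by apply/matrixP=> i j; rewrite !mxE rmorphMn.
Qed.

(* The columns of [C] and of [Z'] form a basis of the column space [R^m], with
   dual basis the rows of [C'] and [Z]; only [C] is hit by the nonzero
   elementary divisors [e]. *)
Lemma Zp_smith_split q m n (M : 'M['Z_q]_(m, n)) :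
  exists (r m' : nat) (e : 'rV['Z_q]_r)
         (C : 'M['Z_q]_(m, r)) (C' : 'M['Z_q]_(r, m))
         (D : 'M['Z_q]_(r, n)) (D' : 'M['Z_q]_(n, r))
         (Z : 'M['Z_q]_(m', m)) (Z' : 'M['Z_q]_(m, m')),
    [/\ (r + m')%N = m, (r <= n)%N, forall i, e 0 i != 0
      & M = C *m diag_mx e *m D]
    /\ [/\ C' *m C = 1%:M, D *m D' = 1%:M, Z *m C = 0, Z *m Z' = 1%:M
      & C *m C' + Z' *m Z = 1%:M].
Proof.
have [L [U [e [uL uU e_mono ->]]]] := Zp_smith M.
have [r [le_rm le_rn e_nz e_z]] : exists r, [/\ (r <= m)%N, (r <= n)%N,
    forall i, (i < r)%N -> e i != 0
    & forall i, (r <= i)%N -> (i < m)%N -> (i < n)%N -> e i = 0].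
  (* The rank [r] is the first index at which a divisor vanishes in ['Z_q], capped at the length of
     the diagonal. *)
  have exP : exists r, (r == minn m n) || (e r == 0).
    by exists (minn m n); rewrite eqxx.
  have [r Pr minr] := ex_minnP exP.
  have le_r : (r <= minn m n)%N by apply: minr; rewrite eqxx.
  move: (le_r); rewrite leq_min => /andP[le_rm le_rn]; exists r; split=> // i.
    by move=> lt_ir; apply: contraL lt_ir => ei; rewrite -leqNgt minr ?ei ?orbT.
  move=> le_ri lt_im lt_in; case/orP: Pr => [/eqP er | /eqP]; last exact: e_mono.
  by move: le_ri; rewrite er leqNgt leq_min lt_im lt_in.
have [m' em] : exists m', m = (r + m')%N by exists (m - r)%N; rewrite subnKC.
have [n' en] : exists n', n = (r + n')%N by exists (n - r)%N; rewrite subnKC.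
subst m n; clear M le_rm.
pose g : 'rV['Z_q]_r := \row_i e i.
have -> : (\matrix_(i, j) (e i *+ (i == j :> nat)) : 'M_(r + m', r + n'))
          = block_mx (diag_mx g) 0 0 0.
  apply/matrixP=> i j; rewrite mxE.
  case: (split_ordP i) => i' ->; case: (split_ordP j) => j' -> /=.
  - by rewrite block_mxEul !mxE.
  - by rewrite block_mxEur mxE ltn_eqF ?mulr0n // ltn_addr.
  - by rewrite block_mxEdl mxE gtn_eqF ?mulr0n // ltn_addr.
  - rewrite block_mxEdr mxE; case: eqP => [ij|_]; last by rewrite mulr0n.
    rewrite e_z ?mul0rn ?leq_addr //=; first by rewrite ltn_add2l.
    by rewrite ij ltn_add2l.
pose V := invmx L; pose W := invmx U.
have VL : col_mx (usubmx V) (dsubmx V) *m row_mx (lsubmx L) (rsubmx L) = 1%:M.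
  by rewrite vsubmxK hsubmxK mulVmx.
have LV : row_mx (lsubmx L) (rsubmx L) *m col_mx (usubmx V) (dsubmx V) = 1%:M.
  by rewrite vsubmxK hsubmxK mulmxV.
have UW : col_mx (usubmx U) (dsubmx U) *m row_mx (lsubmx W) (rsubmx W) = 1%:M.
  by rewrite vsubmxK hsubmxK mulmxV.
exists r, m', g, (lsubmx L), (usubmx V), (usubmx U), (lsubmx W), (dsubmx V), (rsubmx L).
move: VL LV UW; rewrite !mul_col_row mul_row_col.
rewrite (@scalar_mx_block _ r m') (@scalar_mx_block _ r n').
move=> /eq_block_mx[VL1 _ VL3 VL4] LV /eq_block_mx[UW1 _ _ _].
split; split=> //.
- by move=> i; rewrite mxE e_nz.
- rewrite -{1}[L]hsubmxK -{1}[U]vsubmxK mul_row_block !mulmx0 !addr0.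
  by rewrite mul_row_col mul0mx addr0.
Qed.

(** * Factorizations, unimodular sets and matrix representations *)

Lemma right_invertibleP (R : finComNzRingType) k n (M : 'M[R]_(k, n)) :
  reflect (exists N : 'M[R]_(n, k), M *m N = 1%:M) (right_invertible M).
Proof. exact: 'exists_eqP. Qed.

Lemma factors_throughP (R : finComNzRingType) m n (M : 'M[R]_(m, n)) r :
  reflect (exists (C : 'M[R]_(m, r)) (D : 'M[R]_(r, n)), M = C *m D)
          (factors_through M r).
Proof.
apply: (iffP existsP) => [[C /existsP[D /eqP MCD]] | [C [D MCD]]].
  by exists C, D.
by exists C; apply/existsP; exists D; apply/eqP.
Qed.

Lemma inner_rank_min (R : finComNzRingType) m n (M : 'M[R]_(m, n)) r :
  factors_through M r -> (inner_rank M <= r)%N.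
Proof.
by rewrite /inner_rank; case: eqP => // _; case: ex_minnP => ? _; apply.
Qed.

Lemma factors_through_inner_rank (R : finComNzRingType) m n (M : 'M[R]_(m, n)) :
  factors_through M (inner_rank M).
Proof.
rewrite /inner_rank; case: eqP => [-> | _]; last by case: ex_minnP.
(* The conventional value 0 for the zero matrix is a genuine factorization, through matrices of
   inner dimension 0. *)
by apply/factors_throughP; exists 0, 0; rewrite mulmx0.
Qed.

Section Subspaces.
Variables (R : finComNzRingType) (n : nat).
Implicit Types (V W : {set 'rV[R]_n}).

Lemma right_invertible_row_inj k (K : 'M[R]_(k, n)) :
  right_invertible K -> injective (fun i => row i K).
Proof.
case/right_invertibleP=> N KN i j eq_ij; apply/eqP.
have: row i (K *m N) = row j (K *m N) by rewrite !row_mul eq_ij.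
rewrite KN => /rowP/(_ j); rewrite !mxE eqxx.
by case: eqP => //= _ /esym/eqP; rewrite oner_eq0.
Qed.

(** A repeated row would be repeated in the identity matrix, so no row is lost on passing to the
    set; [f] absorbs the order in which [rows_mx] enumerates it. *)
Lemma right_invertible_set_of_rows k (K : 'M[R]_(k, n)) :
    right_invertible K ->
  exists (S : {set 'rV[R]_n}) (f : 'I_#|S| -> 'I_k),
    [/\ #|S| = k, bijective f & rows_mx S = rowsub f K].
Proof.
move=> invK; have row_inj := right_invertible_row_inj invK.
pose S := [set row i K | i : 'I_k].
have f_ex (i : 'I_#|S|) : exists j : 'I_k, enum_val i == row j K.
  by have /imsetP[j _ ->] := enum_valP i; exists j.
pose f i := xchoose (f_ex i).
have fE i : enum_val i = row (f i) K by apply/eqP/(xchooseP (f_ex i)).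
have cardS : #|S| = k by rewrite card_imset // card_ord.
exists S, f; split=> //.
  apply: inj_card_bij; last by rewrite !card_ord cardS.
  by move=> i j fij; apply: enum_val_inj; rewrite !fE fij.
by apply/matrixP=> i j; rewrite !mxE fE mxE.
Qed.

Lemma right_invertible_rowsub k l (f : 'I_l -> 'I_k) (K : 'M[R]_(k, n)) :
  injective f -> right_invertible K -> right_invertible (rowsub f K).
Proof.
move=> f_inj /right_invertibleP[N KN]; apply/right_invertibleP.
exists (colsub f N); rewrite -mxsub_mul KN.
by apply/matrixP=> i j; rewrite !mxE (inj_eq f_inj).
Qed.

(** Trades the maximum over unimodular sets for right invertible matrices, with which all later
    computations are done. *)
Lemma unimod_dimP V k :
    (exists2 K : 'M[R]_(k, n), right_invertible K & forall i, row i K \in V) ->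
    (forall l (K : 'M[R]_(l, n)), right_invertible K ->
       (forall i, row i K \in V) -> (l <= k)%N) ->
  unimod_dim V = k.
Proof.
move=> [K invK KV] maxk; apply/eqP; rewrite eqn_leq; apply/andP; split.
  apply/bigmax_leqP=> S /andP[/subsetP sSV uS]; apply: maxk uS _ => i.
  by rewrite rowK sSV ?enum_valP.
have [S [f [cardS bij_f defS]]] := right_invertible_set_of_rows invK.
rewrite -[X in (X <= _)%N]cardS; apply: leq_bigmax_cond; apply/andP; split.
  apply/subsetP=> v Sv; rewrite -(enum_rankK_in Sv Sv).
  set i := enum_rank_in _ _.
  have <- : row i (rows_mx S) = enum_val i by rewrite rowK.
  by rewrite defS (_ : row i _ = row (f i) K) //; apply/rowP=> j; rewrite !mxE.
by rewrite /unimodular defS right_invertible_rowsub //; apply: bij_inj.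
Qed.

Lemma mx_represents_span k (D : 'M[R]_(k, n)) :
  right_invertible D -> mx_represents D [set x *m D | x : 'rV[R]_k].
Proof.
move=> invD; rewrite /mx_represents /rows_basis invD eqxx andbT /=.
have [N DN] := right_invertibleP _ invD.
apply/forallP=> x; apply/implyP=> /eqP xD0.
by rewrite -[x]mulmx1 -DN mulmxA xD0 mul0mx.
Qed.

Lemma subspace_span k (D : 'M[R]_(k, n)) :
  right_invertible D -> subspace [set x *m D | x : 'rV[R]_k].
Proof.
move=> invD; have [S [f [_ bij_f defS]]] := right_invertible_set_of_rows invD.
apply/existsP; exists S.
have invS : right_invertible (rows_mx S).
  by rewrite defS right_invertible_rowsub //; apply: bij_inj.
suff -> : [set x *m D | x : 'rV[R]_k] = [set x *m rows_mx S | x : 'rV[R]_#|S|].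
  exact: mx_represents_span.
have [g fK gK] := bij_f.
have defD : D = rowsub g (rows_mx S).
  by apply/matrixP=> i j; rewrite defS !mxE gK.
apply/setP=> v; apply/imsetP/imsetP=> -[x _ ->].
  by exists (x *m rowsub g 1%:M) => //; rewrite -mulmxA -rowsubE -defD.
by exists (x *m rowsub f 1%:M) => //; rewrite -mulmxA -rowsubE -defS.
Qed.

Lemma mem_represented k (M : 'M[R]_(k, n)) V v :
  mx_represents M V -> reflect (exists x, v = x *m M) (v \in V).
Proof.
case/and3P=> _ _ /eqP->.
by apply: (iffP imsetP) => [[x _ ->] | [x ->]]; exists x.
Qed.

Lemma rows_represented k l (M : 'M[R]_(k, n)) (K : 'M[R]_(l, n)) V :
    mx_represents M V ->
  (forall i, row i K \in V) <-> (exists X, K = X *m M).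
Proof.
move=> MV; split=> [KV | [X ->] i]; last first.
  by apply/(mem_represented _ MV); exists (row i X); rewrite row_mul.
have /fin_all_exists[X XE] i : exists x, row i K = x *m M.
  exact/(mem_represented _ MV).
by exists (\matrix_i X i); apply/row_matrixP=> i; rewrite row_mul rowK.
Qed.

End Subspaces.

(** * Kernel vectors, the socle and the inner rank *)

(** As [r <= n < m], the kernel part [Z] of the split form has at least one row. The condition on
    [y] is stronger than [x != 0]: it keeps [c *: x] nonzero for every [c != 0], as the rank bounds
    require. *)
Lemma Zp_left_kernel_vector q m n (M : 'M['Z_q]_(m, n)) : (n < m)%N ->
  exists (x : 'rV['Z_q]_m) (y : 'cV['Z_q]_m), x *m y = 1%:M /\ x *m M = 0.
Proof.
have [r [m' [e [C [C' [D [D' [Z [Z']]]]]]]]] := Zp_smith_split M.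
move=> [[def_m le_rn _ ->] [_ _ ZC ZZ _]] lt_nm.
have m'_gt0 : (0 < m')%N.
  by move: (leq_ltn_trans le_rn lt_nm); rewrite -def_m -{1}[r]addn0 ltn_add2l.
pose i := Ordinal m'_gt0; exists (row i Z), (col i Z'); split.
  rewrite colE mulmxA -row_mul ZZ -colE.
  by apply/matrixP=> j k; rewrite !mxE !ord1 !eqxx.
by rewrite -row_mul !mulmxA ZC !mul0mx row0.
Qed.

Lemma Zp_right_invertible_leq q k n (K : 'M['Z_q]_(k, n)) :
  right_invertible K -> (k <= n)%N.
Proof.
case/right_invertibleP=> N KN; rewrite leqNgt; apply/negP=> lt_nk.
have [x [y [xy xK]]] := Zp_left_kernel_vector K lt_nk.
have x0 : x = 0 by rewrite -[x]mulmx1 -KN mulmxA xK mul0mx.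
move: xy; rewrite x0 mul0mx => /matrixP/(_ 0 0); rewrite !mxE eqxx.
by move/esym/eqP; rewrite oner_eq0.
Qed.

(** For nonzero [x] the gcd with [p ^ s] is [p ^ e] with [e < s], so Bezout gives a multiple of [x]
    equal to [p ^ e] in the ring, and [p ^ s.-1] is a multiple of that. *)
Lemma Zp_socle p s : prime p -> (0 < s)%N ->
  exists2 c : 'Z_(p ^ s), c != 0 & forall x, x != 0 -> exists y, x * y = c.
Proof.
move=> p_pr s_gt0; set q := (p ^ s)%N.
have p_gt1 := prime_gt1 p_pr.
have q_gt1 : (1 < q)%N by rewrite -(exp1n s) ltn_exp2r.
have q_gt0 := ltnW q_gt1.
exists (p ^ s.-1)%:R => [|x x_nz].
  apply/eqP=> /(congr1 val)/=; rewrite val_Zp_nat //.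
  rewrite modn_small ?ltn_exp2l ?ltn_predL // => /eqP.
  by rewrite expn_eq0 -leqn0 leqNgt prime_gt0.
have x_gt0 : (0 < x)%N.
  by rewrite lt0n; apply: contraNneq x_nz => x0; apply/eqP/val_inj.
have [u v def_g _] := egcdnP q x_gt0.
have [e le_es def_q] : exists2 e, (e <= s)%N & gcdn x q = (p ^ e)%N.
  by apply/(dvdn_pfactor _ _ p_pr)/dvdn_gcdr.
(* If [e = s], then [q] divides [x], against [0 < x < q]. *)
have lt_es : (e < s)%N.
  rewrite ltn_neqAle le_es andbT; apply: contraTneq x_gt0 => es.
  have := dvdn_gcdl x q; rewrite def_q es => /dvdn_leq le_qx.
  rewrite -leqNgt leqNgt; apply/negP=> /le_qx; rewrite leqNgt.
  by rewrite -[X in (_ < X)%N](Zp_cast q_gt1) ltn_ord.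
exists (u * p ^ (s.-1 - e))%:R.
rewrite -{1}[x]natr_Zp -natrM mulnA [(x * u)%N]mulnC def_g def_q natrM natrD natrM.
rewrite pchar_Zp // mulr0 add0r -natrM -expnD subnKC //.
by rewrite -ltnS prednK.
Qed.

Lemma Zp_pk_inner_rank p s m n (M : 'M['Z_(p ^ s)]_(m, n)) :
    prime p -> (0 < s)%N ->
  exists r m' : nat,
  [/\ inner_rank M = r, (r + m')%N = m,
      exists C (D : 'M_(r, n)), right_invertible D /\ M = C *m D,
      exists2 Z : 'M_(m', m), right_invertible Z & Z *m M = 0
    & forall k (Y : 'M_(k, m)), right_invertible Y -> Y *m M = 0 -> (k <= m')%N].
Proof.
move=> p_pr s_gt0; have [c c_nz c_dvd] := Zp_socle p_pr s_gt0.
have [r [m' [e [C [C' [D [D' [Z [Z']]]]]]]]] := Zp_smith_split M.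
move=> [[def_m le_rn e_nz defM] [C'C DD' ZC ZZ' CZ]]; exists r, m'.
have /fin_all_exists[g gE] i : exists y, e 0 i * y = c by exact: c_dvd.
have eg : diag_mx e *m diag_mx (\row_i g i) = c%:M.
  rewrite mulmx_diag; apply/matrixP=> i j; rewrite !mxE.
  by rewrite gE.
(* A unimodular vector is not annihilated by [c]; both bounds below contradict this. *)
have not_c0 k (x : 'rV_k) y : x *m y = 1%:M -> c *: x <> 0.
  move=> xy cx0; have: c *: (x *m y) = 0 by rewrite scalemxAl cx0 mul0mx.
  rewrite xy => /matrixP/(_ 0 0); rewrite !mxE eqxx mulr1 => /eqP.
  by rewrite (negPf c_nz).
split=> //.
- apply/eqP; rewrite eqn_leq inner_rank_min /=; last first.
    by apply/factors_throughP; exists (C *m diag_mx e), D.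
  have /factors_throughP[C2 [D2 M2]] := factors_through_inner_rank M.
  (* With fewer than [r] inner dimensions, some unimodular [x] kills [C' *m C2], hence
     [C' *m M *m D' = diag_mx e], hence [c%:M]. *)
  rewrite leqNgt; apply/negP=> lt_rk.
  have [x [y [xy xK]]] := Zp_left_kernel_vector (C' *m C2) lt_rk.
  apply: (not_c0 _ x y xy); rewrite -mul_mx_scalar -eg.
  have -> : diag_mx e = C' *m M *m D'.
    by rewrite defM !mulmxA C'C mul1mx -mulmxA DD' mulmx1.
  by rewrite M2 !mulmxA -(mulmxA x) xK !mul0mx.
- exists (C *m diag_mx e), D; split=> //.
  by apply/right_invertibleP; exists D'.
- exists Z; first by apply/right_invertibleP; exists Z'.
  by rewrite defM !mulmxA ZC !mul0mx.
move=> k Y /right_invertibleP[Y' YY'] YM; rewrite leqNgt; apply/negP=> lt_k.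
(* Since [x] kills [Y *m Z'], the splitting of the identity gives [x *m Y = x *m Y *m C *m C']. But
   [c] kills [Y *m C], because [Y *m M = 0], so it kills the unimodular vector [x *m Y]. *)
have [x [y [xy xK]]] := Zp_left_kernel_vector (Y *m Z') lt_k.
have cYC : Y *m C *m c%:M = 0.
  have YCe : Y *m C *m diag_mx e = Y *m M *m D'.
    by rewrite defM !mulmxA -[RHS]mulmxA DD' mulmx1.
  by rewrite -eg mulmxA YCe YM !mul0mx.
apply: (not_c0 _ (x *m Y) (Y' *m y)).
  by rewrite mulmxA -(mulmxA x) YY' mulmx1.
rewrite -[Y]mulmx1 -CZ !mulmxDr !mulmxA -(mulmxA x Y Z') xK mul0mx addr0.
by rewrite scalemxAl -mul_mx_scalar -!(mulmxA x) mulmxA cYC mulmx0 mul0mx.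
Qed.

(** A unimodular family in [V] has a right invertible coordinate matrix with respect to [M], hence
    at most [k] members. *)
Lemma unimod_dim_represented q n k (M : 'M['Z_q]_(k, n)) V :
  mx_represents M V -> unimod_dim V = k.
Proof.
move=> MV; apply: unimod_dimP.
  exists M; first by case/andP: MV.
  by apply/(rows_represented _ MV); exists 1%:M; rewrite mul1mx.
move=> l K /right_invertibleP[N KN] /(rows_represented _ MV)[X defK].
apply: (@Zp_right_invertible_leq q _ _ X).
by apply/right_invertibleP; exists (M *m N); rewrite mulmxA -defK.
Qed.

(** * Dimensions of the join and of the intersection *)

Section JoinAndMeet.
Variables (p s n a b : nat) (A B : {set 'rV['Z_(p ^ s)]_n}).
Variables (MA : 'M['Z_(p ^ s)]_(a, n)) (MB : 'M['Z_(p ^ s)]_(b, n)).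
Hypotheses (p_pr : prime p) (s_gt0 : (0 < s)%N).
Hypotheses (repA : mx_represents MA A) (repB : mx_represents MB B).

Lemma dim_join_inner_rank : dim_join A B = inner_rank (col_mx MA MB).
Proof.
have [r [m' [rankM _ [C [D [invD MCD]]] _ _]]] :=
  Zp_pk_inner_rank (col_mx MA MB) p_pr s_gt0.
rewrite /dim_join; case: ex_minnP => d /existsP[W /andP[upW /eqP dimW]] mind.
apply/eqP; rewrite eqn_leq rankM; apply/andP; split.
  (* The row span of the unimodular factor [D] contains [A] and [B]. *)
  apply: mind; apply/existsP; exists [set x *m D | x : 'rV_r].
  rewrite (unimod_dim_represented (mx_represents_span invD)) eqxx andbT.
  rewrite /upper_subspace subspace_span //=.
  move: MCD; rewrite -{1}[C]vsubmxK mul_col_mx => /eq_col_mx[defA defB].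
  apply/andP; split; apply/subsetP=> v.
    by case/(mem_represented _ repA)=> x ->; rewrite defA mulmxA; apply: imset_f.
  by case/(mem_represented _ repB)=> x ->; rewrite defB mulmxA; apply: imset_f.
case/and3P: upW => /existsP[S repW] /subsetP sAW /subsetP sBW.
(* Conversely, writing [MA] and [MB] in a basis of [W] factors the stacked matrix through the
   dimension of [W]. *)
rewrite -dimW (unimod_dim_represented repW) -rankM inner_rank_min //.
have [XA defA] : exists X, MA = X *m rows_mx S.
  apply/(rows_represented _ repW) => i; apply: sAW; move: i.
  by apply/(rows_represented _ repA); exists 1%:M; rewrite mul1mx.
have [XB defB] : exists X, MB = X *m rows_mx S.
  apply/(rows_represented _ repW) => i; apply: sBW; move: i.
  by apply/(rows_represented _ repB); exists 1%:M; rewrite mul1mx.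
apply/factors_throughP; exists (col_mx XA XB), (rows_mx S).
by rewrite mul_col_mx -defA -defB.
Qed.

(* Unimodular families in [A :&: B] correspond to unimodular families of linear
   relations between the rows of [col_mx MA MB]. *)
Lemma unimod_dim_meet :
  (unimod_dim (A :&: B) + inner_rank (col_mx MA MB))%N = (a + b)%N.
Proof.
have [r [m' [-> def_ab _ [Z invZ ZM] maxZ]]] :=
  Zp_pk_inner_rank (col_mx MA MB) p_pr s_gt0.
rewrite -[RHS]def_ab addnC; congr (_ + _)%N; apply: unimod_dimP => [|k K invK KAB].
  (* A relation [Z1 *m MA + Z2 *m MB = 0] makes [Z1 *m MA = - Z2 *m MB] a family in both
     subspaces. *)
  exists (lsubmx Z *m MA) => [|i]; last first.
    move: ZM; rewrite -[Z]hsubmxK mul_row_col hsubmxK => /eqP.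
    rewrite addr_eq0 -mulNmx => /eqP eqAB; rewrite inE; apply/andP; split.
      by apply/(rows_represented _ repA): i; exists (lsubmx Z).
    move: i; apply/(rows_represented _ repB).
    by rewrite eqAB; exists (- rsubmx Z).
  case/andP: repA => /right_invertibleP[NA MAK] _.
  case/andP: repB => /right_invertibleP[NB MBK] _.
  case/right_invertibleP: invZ => N; rewrite -{1}[Z]hsubmxK -[N]vsubmxK.
  move: ZM; rewrite -{1}[Z]hsubmxK !mul_row_col; set X := lsubmx Z.
  move=> /eqP; rewrite addr_eq0 => /eqP eqAB ZN; apply/right_invertibleP.
  (* [NA] recovers [Z1] from [Z1 *m MA] and [NB] recovers [- Z2] from the same matrix; the sign
     turns the product into [Z *m N]. *)
  exists (NA *m usubmx N - NB *m dsubmx N).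
  rewrite mulmxBr !mulmxA -(mulmxA X) MAK mulmx1 eqAB.
  by rewrite mulNmx mulNmx -(mulmxA _ MB) MBK mulmx1 opprK.
have [X defX] : exists X, K = X *m MA.
  by apply/(rows_represented _ repA) => i; have := KAB i; rewrite inE => /andP[].
have [Y defY] : exists Y, K = Y *m MB.
  by apply/(rows_represented _ repB) => i; have := KAB i; rewrite inE => /andP[].
(* The two coordinate matrices of [K] give a relation; its right inverse needs only the [MA]
   half. *)
apply: (maxZ _ (row_mx X (- Y))); last first.
  by rewrite mul_row_col mulNmx -defX -defY subrr.
case/right_invertibleP: invK => N KN; apply/right_invertibleP.
by exists (col_mx (MA *m N) 0); rewrite mul_row_col mulmx0 addr0 mulmxA -defX.
Qed.

End JoinAndMeet.

Theorem theorem3p2 (p s n : nat) (A B : {set 'rV['Z_(p ^ s)]_n}) :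
  prime p -> (1 <= s)%N -> subspace A -> subspace B ->
  (dim_join A B)%:Z = (unimod_dim A)%:Z + (unimod_dim B)%:Z - (unimod_dim (A :&: B))%:Z
  /\ (forall (a b : nat) (MA : 'M['Z_(p ^ s)]_(a, n)) (MB : 'M['Z_(p ^ s)]_(b, n)),
        mx_represents MA A -> mx_represents MB B ->
        (unimod_dim A)%:Z + (unimod_dim B)%:Z - (unimod_dim (A :&: B))%:Z
        = (inner_rank (col_mx MA MB))%:Z).
Proof.
move=> p_pr s_gt0 /existsP[SA repA] /existsP[SB repB].
(* Proved for arbitrary representations, then specialized to the bases [SA] and [SB] for the
   join. *)
have rankE a b (MA : 'M['Z_(p ^ s)]_(a, n)) (MB : 'M['Z_(p ^ s)]_(b, n)) :
    mx_represents MA A -> mx_represents MB B ->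
    (unimod_dim A)%:Z + (unimod_dim B)%:Z - (unimod_dim (A :&: B))%:Z
    = (inner_rank (col_mx MA MB))%:Z.
  move=> rA rB; rewrite (unimod_dim_represented rA) (unimod_dim_represented rB).
  apply/eqP; rewrite subr_eq -!PoszD eqz_nat [eqbRHS]addnC.
  by rewrite (unimod_dim_meet p_pr s_gt0 rA rB).
split=> //.
by rewrite (rankE _ _ _ _ repA repB) (dim_join_inner_rank p_pr s_gt0 repA repB).
Qed.
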